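(* Let $(G,d)$ be a strongly connected graph with absorption on $n\ge2$ vertices, with graph Laplacian $L$, let $L^d$ be the absorption inverse of $L$ with respect to $d$, and let $\tilde G$ be the corresponding absorption-scaled graph. Then $$L^d=\frac{\tilde\sigma_{n-2}}{\tilde\sigma_{n-1}}\,D^{-1}\left[\tilde J_{n-2}-\tilde J_{n-1}\right],$$ i.e., for all $i,j\in\{1,\dots,n\}$, $$L^d_{ij}=\frac{\omega(\tilde{\mathcal F}^{\,j\to i}_{n-2})}{d_i\,\tilde\sigma_{n-1}}-\frac{\tilde\sigma_{n-2}\,u_i}{\tilde\sigma_{n-1}\,\bar d}.$$
   Context: $G$ is a strongly connected, weighted, directed graph on $V=\{1,\dots,n\}$ with weighted adjacency matrix $A=(a_{ij})\in\mathbb{R}^{n\times n}$, $a_{ij}\ge 0$, where $a_{ij}$ is the weight of the edge from $j$ to $i$ (with $a_{ij}>0$ exactly when that edge is present). The outdegrees are $w_i=\sum_{j=1}^n a_{ji}$, $W=\mathrm{diag}\{w\}$, and the graph Laplacian is $L=W-A$. The vector $d=(d_1,\dots,d_n)^T$ has all $d_i>0$ (absorption rates), and $D=\mathrm{diag}\{d\}$. The kernel of $L$ is one-dimensional; $u$ denotes its unique spanning vector with positive entries and $\sum_i u_i=1$. Put $\bar d=d^Tu$. Let $N_{1,0}=\{x\in\mathbb{R}^n: Dx\in\mathrm{range}\,L\}$ and $R_{1,0}=\{Dx: x\in\ker L\}$. The absorption inverse $L^d$ of $L$ with respect to $d$ is the (unique) matrix $X\in\mathbb{R}^{n\times n}$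 with $XLy=y$ for all $y\in N_{1,0}$ and $Xy=0$ for all $y\in R_{1,0}$. The absorption-scaled graph $\tilde G$ is the weighted directed graph on $V$ with adjacency matrix $\tilde A=AD^{-1}$, i.e. edge weights $\tilde a_{ij}=a_{ij}/d_j$ for the edge from $j$ to $i$. The weight $\omega(\Gamma)$ of a subgraph $\Gamma$ of $\tilde G$ is the product of the weights $\tilde a_{ij}$ of its arcs (empty product $=1$); the weight of a set of subgraphs is the sum of the weights of its members (the empty set has weight $0$). A converging tree is a weakly connected directed graph (its underlying undirected graph is a tree) in which one vertex, the root, has no outgoing arc and every other vertex has exactly one outgoing arc. An in-forest of $\tilde G$ is a spanning subgraph (containing all vertices) all of whose weakly connected components are converging trees. $\tilde{\mathcal F}_k$ is the set of in-forests of $\tilde G$ with exactly $k$ arcs (equivalently $n-k$ trees), and $\tilde{\mathcal F}_k^{\,i\to j}\subseteq\tilde{\mathcal F}_k$ is the set of those in which vertex $i$ belongs to a tree with root $j$. Set $\tilde\sigma_k=\omega(\tilde{\mathcal F}_k)$, let $\tilde Q_k$ be the $n\times n$ matrix with $[\tilde Q_k]_{ij}=\omega(\tilde{\mathcal F}_k^{\,j\to i})$, and let $\tilde J_k=\tilde Q_k/\tilde\sigma_k$. *)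

(* Defs.v *)
From HB Require Import structures.
From mathcomp Require Import all_boot all_order all_algebra.
From mathcomp Require Import classical_sets.

Set Implicit Arguments.
Unset Strict Implicit.
Unset Printing Implicit Defensive.

Import Order.TTheory GRing.Theory Num.Theory.

(* A digraph on a vertex type T is given by a set of arcs; the pair (x, y) is
   the arc from x to y. *)
Section Digraph.
Variable T : finType.
Implicit Types (V : {set T}) (S : {set T * T}).

Definition underlying S : rel T :=
  [rel x y | ((x, y) \in S) || ((y, x) \in S)].

Definition outdegree S (x : T) : nat := #|[set y | (x, y) \in S]%SET|.

Definition weakly_connected V S : bool :=
  (V != finset.set0) &&
  [forall x in V, forall y in V, connect (underlying S) x y].

(* A cycle of an undirected graph is a cyclic sequence of at least three
   distinct vertices; a duplicate-free sequence has at most #|T| terms, which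
   is why bounding k by #|T| loses nothing. *)
Definition acyclic S : bool :=
  [forall x, ~~ underlying S x x] &&
  [forall k : 'I_#|T|.+1, forall c : k.-tuple T,
     (2 < k) ==> ~~ ucycleb (underlying S) c].

Definition is_tree V S : bool := weakly_connected V S && acyclic S.

Definition converging_tree_rooted V S (r : T) : bool :=
  [&& is_tree V S, r \in V, outdegree S r == 0 &
      [forall x in V, (x != r) ==> (outdegree S x == 1)]].

Definition converging_tree V S : bool :=
  [exists r, converging_tree_rooted V S r].

Definition component S (x : T) : {set T} :=
  [set y | connect (underlying S) x y]%SET.

Definition component_arcs S (x : T) : {set T * T} :=
  [set e in S | (e.1 \in component S x) && (e.2 \in component S x)]%SET.

(* The vertex set is all of T, so a forest is automatically spanning. *)
Definition in_forest S : bool :=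
  [forall x, converging_tree (component S x) (component_arcs S x)].

Definition in_tree_rooted_at S (x r : T) : bool :=
  converging_tree_rooted (component S x) (component_arcs S x) r.

End Digraph.

Local Open Scope ring_scope.

(* M i j is the weight of the edge from j to i, which is present exactly when
   M i j > 0. *)
Section WeightedGraph.
Variables (R : realFieldType) (n : nat) (M : 'M[R]_n).

Definition arcs : {set 'I_n * 'I_n} := [set e | 0 < M e.2 e.1]%SET.

Definition strongly_connected : Prop :=
  forall i j : 'I_n, connect [rel x y | (x, y) \in arcs] i j.

Definition laplacian : 'M[R]_n := diag_mx (\row_i \sum_j M j i) - M.

Definition weight (S : {set 'I_n * 'I_n}) : R := \prod_(e in S) M e.2 e.1.

Definition set_weight (F : {set {set 'I_n * 'I_n}}) : R :=
  \sum_(S in F) weight S.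

Definition forests (k : nat) : {set {set 'I_n * 'I_n}} :=
  [set S : {set 'I_n * 'I_n} | [&& S \subset arcs, in_forest S & #|S| == k]]%SET.

Definition forests_to (k : nat) (i j : 'I_n) : {set {set 'I_n * 'I_n}} :=
  [set S in forests k | in_tree_rooted_at S i j]%SET.

Definition sigma (k : nat) : R := set_weight (forests k).

Definition Qmx (k : nat) : 'M[R]_n :=
  \matrix_(i, j) set_weight (forests_to k j i).

Definition Jmx (k : nat) : 'M[R]_n := (sigma k)^-1 *: Qmx k.

End WeightedGraph.

Section Absorption.
Variables (R : realFieldType) (n : nat).
Implicit Types (A L X : 'M[R]_n) (d : 'cV[R]_n).

Definition Dmx d : 'M[R]_n := diag_mx d^T.

Definition absorption_scaled A d : 'M[R]_n := A *m invmx (Dmx d).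

Definition N10 L d : set 'cV[R]_n :=
  [set x | range (fun z : 'cV[R]_n => L *m z) (Dmx d *m x)]%classic.

Definition R10 L d : set 'cV[R]_n :=
  [set Dmx d *m x | x in [set x : 'cV[R]_n | L *m x = 0]]%classic.

Definition is_absorption_inverse L d X : Prop :=
  (forall y, N10 L d y -> X *m L *m y = y) /\
  (forall y, R10 L d y -> X *m y = 0).

(* Definite description: the default value 0 is irrelevant whenever a matrix
   with the defining property exists. *)
Definition absorption_inverse L d : 'M[R]_n :=
  xget 0 (is_absorption_inverse L d).

End Absorption.

(* Main.v *)
(* Encode an in-forest by the map sending each vertex to the head of its outgoing
   arc, and each root to itself. Comparing forests that differ in the arc leaving
   [j] gives the recursion Q_k L~ = sigma_{k+1} I - Q_{k+1} for the Laplacian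
   L~ = L D^-1 of the scaled graph, so that every Q_k is a polynomial in L~.
   In particular Q_{n-1} L~ = 0 and Q_{n-2} L~ = sigma_{n-1} I - Q_{n-1}; by the
   maximum principle the rows of Q_{n-1} are constant, hence
   Q_{n-1} = (sigma_{n-1} / dbar) D u 1^T. The absorption inverse is then
   sigma_{n-1}^-1 D^-1 Z with Z = Q_{n-2} - (sigma_{n-2} / sigma_{n-1}) Q_{n-1},
   which satisfies Z L~ = L~ Z = sigma_{n-1} I - Q_{n-1} and kills ker L~. *)
Require Import Defs.
From mathcomp Require Import all_boot all_order all_algebra.
From mathcomp Require Import ring.

Set Implicit Arguments.
Unset Strict Implicit.
Unset Printing Implicit Defensive.

Import Order.TTheory GRing.Theory Num.Theory.
Local Open Scope ring_scope.

(** * Rooted forests as self-maps of the vertex set *)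

Section ForestFunctions.
Variable T : finType.
Implicit Types (f g : {ffun T -> T}) (x y z r j m : T).

(* [f] maps a vertex to the head of its outgoing arc; fixed points are roots. *)
Definition sink f x : T := iter #|T| f x.

(** An orbit that has not reached a fixed point after [#|T|] steps never does, so this says that [f]
    has no cycle besides its fixed points. *)
Definition forest_fun f : bool := [forall x, f (sink f x) == sink f x].

(** The case [m = j] deletes the arc out of [j] and makes [j] a root. *)
Definition redirect f j m : {ffun T -> T} :=
  [ffun x => if x == j then m else f x].

Lemma forest_funP f : forest_fun f -> forall x, f (sink f x) = sink f x.
Proof. by move/forallP=> Hf x; apply/eqP. Qed.

Lemma sink_fixed f x : f x = x -> sink f x = x.
Proof. by move=> fx; rewrite /sink; elim: #|T| => //= k ->. Qed.

Lemma sink_step f x : forest_fun f -> sink f (f x) = sink f x.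
Proof. by move=> Ff; rewrite /sink -iterSr iterS -/(sink f x) forest_funP. Qed.

Lemma sink_fixedE f x : forest_fun f -> (sink f x == x) = (f x == x).
Proof.
move=> Ff; apply/eqP/eqP => [<-|]; [exact: forest_funP | exact: sink_fixed].
Qed.

(** Being constant along [f] and correct at roots determines the root map; this computes sinks of
    altered maps without following their iterates. *)
Lemma sink_unique f (rho : T -> T) : forest_fun f ->
  (forall x, rho (f x) = rho x) -> (forall x, f x = x -> rho x = x) ->
  rho =1 sink f.
Proof.
move=> Ff step fixed x; rewrite -[RHS]fixed ?forest_funP // /sink.
by elim: #|T| => //= k ->.
Qed.

Lemma fconnect_sink f x r : fconnect f x r -> f r = r -> sink f x = r.
Proof.
move=> cr fr; have Hi : (findex f x r <= #|T|)%N.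
  exact: leq_trans (ltnW (findex_max cr)) (max_card _).
rewrite /sink -(subnK Hi) iterD iter_findex //.
by elim: (_ - _)%N => //= i ->.
Qed.

(** For a forest this is the distance from [x] to its root. *)
Definition height f x : nat := (\sum_(k < #|T|) (iter k f x != sink f x))%N.

Lemma height_step f x : forest_fun f -> f x != x -> (height f (f x) < height f x)%N.
Proof.
move=> Ff fx; rewrite /height sink_step //.
suff -> : (\sum_(k < #|T|) (iter k f x != sink f x) =
   (\sum_(k < #|T|) (iter k f (f x) != sink f x)).+1)%N by [].
(* Both sides count the iterates of [x] of index 0 to [N] that differ from the root, splitting off
   the last one or the first one. *)
have /(_ #|T|) E : forall N, ((\sum_(k < N) (iter k f x != sink f x)) + (iter N f x != sink f x)
   = (x != sink f x) + \sum_(k < N) (iter k f (f x) != sink f x))%N.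
  move=> N; transitivity (\sum_(k < N.+1) (iter k f x != sink f x))%N.
    by rewrite big_ord_recr.
  by rewrite big_ord_recl; congr addn; apply: eq_bigr => k _; rewrite /= -iterSr.
move: E; rewrite -/(sink f x) eqxx addn0 => ->.
by rewrite eq_sym sink_fixedE // fx.
Qed.

(* A strictly decreasing height characterizes forests, and is easier to transport
   through a change of arc than the iterates of the map. *)
Lemma forest_fun_of_height f (h : T -> nat) :
  (forall x, f x != x -> (h (f x) < h x)%N) -> forest_fun f.
Proof.
move=> hlt; suff HF x : exists k, (f (iter k f x) == iter k f x).
  apply/forallP => x; have [k /eqP Hk] := HF x.
  by rewrite (fconnect_sink (fconnect_iter _ k _) Hk) Hk.
have [N] := ubnP (h x); elim: N x => // N IH x; rewrite ltnS => hx.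
have [fx|fx] := eqVneq (f x) x; first by exists 0%N; rewrite /= fx.
have [k Hk] := IH (f x) (leq_trans (hlt _ fx) hx).
by exists k.+1; rewrite iterSr.
Qed.

Lemma leq_height_sink f (h : T -> nat) x :
  (forall y, f y != y -> (h (f y) < h y)%N) -> (h (sink f x) <= h x)%N.
Proof.
move=> hlt; rewrite /sink; elim: #|T| => //= k; apply: leq_trans.
by case: (eqVneq (f (iter k f x)) (iter k f x)) => [->//|/hlt/ltnW].
Qed.

Lemma redirect_at f j m : redirect f j m j = m.
Proof. by rewrite ffunE eqxx. Qed.

Lemma redirect_other f j m x : x != j -> redirect f j m x = f x.
Proof. by rewrite ffunE => /negbTE->. Qed.

Lemma redirectK f j m : f j = j -> redirect (redirect f j m) j j = f.
Proof. by move=> fj; apply/ffunP => x; rewrite !ffunE; case: eqP => // ->. Qed.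

Lemma redirect_self f j m : redirect (redirect f j m) j (f j) = f.
Proof. by apply/ffunP => x; rewrite !ffunE; case: eqP => // ->. Qed.

(** The new arc closes no cycle because its head [m] lies outside the tree rooted at [j]. *)
Lemma forest_fun_redirect f j m : forest_fun f -> f j = j -> sink f m != j ->
  forest_fun (redirect f j m).
Proof.
move=> Ff fj mj.
(* The tree of [j] is now hung below [m], so its heights are raised by the height of [m] plus
   one. *)
apply: (@forest_fun_of_height _
  (fun x => height f x + (if sink f x == j then (height f m).+1 else 0)))%N => x.
have [->|xj] := eqVneq x j.
  rewrite redirect_at (negbTE mj) (sink_fixed fj) eqxx => _.
  by rewrite addn0 addnS ltnS leq_addl.
rewrite redirect_other // sink_step // ltn_add2r; exact: height_step.
Qed.

Lemma sink_redirect f j m x : forest_fun f -> f j = j -> sink f m != j ->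
  sink (redirect f j m) x = if sink f x == j then sink f m else sink f x.
Proof.
move=> Ff fj mj; symmetry; move: x; apply: sink_unique.
- exact: forest_fun_redirect.
- move=> x; have [->|xj] := eqVneq x j.
    by rewrite redirect_at (negbTE mj) (sink_fixed fj) eqxx.
  by rewrite redirect_other // sink_step.
- move=> x; have [->|xj] := eqVneq x j.
    by rewrite redirect_at => mE; rewrite mE (sink_fixed fj) eqxx in mj.
  by rewrite redirect_other // => /sink_fixed->; rewrite (negbTE xj).
Qed.

Lemma redirect_cut_lt f j : forest_fun f -> forall x,
  redirect f j j x != x -> (height f (redirect f j j x) < height f x)%N.
Proof.
move=> Ff x; have [->|xj] := eqVneq x j; first by rewrite redirect_at eqxx.
by rewrite redirect_other //; apply: height_step.
Qed.

Lemma forest_fun_cut f j : forest_fun f -> forest_fun (redirect f j j).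
Proof. by move=> Ff; apply: forest_fun_of_height (redirect_cut_lt Ff). Qed.

(** The old height still decreases along the cut map, so from [f j] it never climbs back to the
    height of [j]. *)
Lemma sink_cut f j : forest_fun f -> f j != j -> sink (redirect f j j) (f j) != j.
Proof.
move=> Ff fj; apply/eqP => E.
have := leq_height_sink (f j) (redirect_cut_lt (j := j) Ff).
by rewrite E leqNgt height_step.
Qed.

(** * Correspondence between forest maps and in-forests as arc sets *)

Definition fun_arcs f : {set T * T} := [set e | (e.2 == f e.1) && (f e.1 != e.1)]%SET.

Definition arc_count f : nat := #|[set x | f x != x]%SET|.

Lemma arc_count_redirect f j m : f j = j -> m != j ->
  arc_count (redirect f j m) = (arc_count f).+1.
Proof.
move=> fj mj; rewrite /arc_count (cardsD1 j) inE redirect_at mj add1n; congr _.+1.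
apply: eq_card => x; rewrite !inE ffunE; case: eqP => [->|//].
by rewrite fj eqxx.
Qed.

Lemma in_fun_arcs f x y : ((x, y) \in fun_arcs f) = (y == f x) && (f x != x).
Proof. by rewrite inE. Qed.

Lemma fun_arcsE f : fun_arcs f = [set (x, f x) | x in [set x | f x != x]]%SET.
Proof.
apply/setP=> -[x y]; rewrite in_fun_arcs; apply/andP/imsetP => [[/eqP-> fx]|].
  by exists x; rewrite ?inE.
by case=> z; rewrite inE => fz [-> ->].
Qed.

Lemma card_fun_arcs f : #|fun_arcs f| = arc_count f.
Proof. by rewrite fun_arcsE card_imset // => x y []. Qed.

Lemma underlyingE (S : {set T * T}) x y :
  underlying S x y = ((x, y) \in S) || ((y, x) \in S).
Proof. by []. Qed.

Lemma underlying_sym (S : {set T * T}) : symmetric (underlying S).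
Proof. by move=> x y; rewrite !underlyingE orbC. Qed.

Lemma connect_fun_arcs f x y : forest_fun f ->
  connect (underlying (fun_arcs f)) x y = (sink f x == sink f y).
Proof.
move=> Ff; apply/idP/eqP=> [/connectP[p + ->]|E].
  elim: p x => //= z p IH x /andP[xz /IH <-].
  by move: xz; rewrite underlyingE !in_fun_arcs => /orP[]/andP[/eqP-> _]; rewrite sink_step.
have cs z : connect (underlying (fun_arcs f)) z (sink f z).
  rewrite /sink; elim: #|T| => //= k IH; apply: connect_trans IH _.
  set w := iter k f z; have [->//|fw] := eqVneq (f w) w.
  by apply: connect1; rewrite underlyingE in_fun_arcs eqxx fw.
apply: connect_trans (cs x) _.
by rewrite E (sym_connect_sym (@underlying_sym _)).
Qed.

(* In an undirected cycle both neighbours of a vertex [v] of maximal height would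
   have to be [f v]. *)
Lemma acyclic_fun_arcs f : forest_fun f -> acyclic (fun_arcs f).
Proof.
move=> Ff; apply/andP; split.
  apply/forallP=> x; rewrite underlyingE in_fun_arcs orbb; apply/negP=> /andP[/eqP <-].
  by rewrite eqxx.
apply/forallP=> k; apply/forallP=> c; apply/implyP=> k2; apply/negP=> /andP[].
move: (tval c) (size_tuple c) => {}c ck cyc un.
have [x0 x0c] : exists x, x \in c.
  by case: c ck {cyc un} => [E|x s _]; [rewrite -E in k2 | exists x; rewrite inE eqxx].
case: (arg_maxnP (height f) x0c) => v vc vmax.
have nbr y : y \in c -> underlying (fun_arcs f) v y -> y = f v.
  move=> yc; rewrite underlyingE !in_fun_arcs => /orP[/andP[/eqP//]|/andP[/eqP E fy]].
  by have := vmax _ yc; rewrite /= leqNgt E height_step.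
have [i s cE] := rot_to vc.
have sc y : y \in v :: s -> y \in c by rewrite -cE mem_rot.
have sk : size (v :: s) = k by rewrite -cE size_rot.
rewrite -(rot_cycle i) cE in cyc; rewrite -(rot_uniq i) cE in un.
case: s => [|a [|b t]] in cE sc sk cyc un *; try by rewrite -sk in k2.
have /and3P[va _ pt] : [&& underlying (fun_arcs f) v a, underlying (fun_arcs f) a b
    & path (underlying (fun_arcs f)) b (rcons t v)] := cyc.
have lv : underlying (fun_arcs f) (last b t) v by move: pt; rewrite rcons_path => /andP[].
have aE : a = f v by apply: nbr va; rewrite sc // !inE eqxx orbT.
have lE : last b t = f v.
  by apply: nbr; [rewrite sc // in_cons (in_cons a) mem_last !orbT | rewrite underlying_sym].
have /and3P[_ + _] := un; rewrite aE -lE.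
by rewrite mem_last.
Qed.

(** An arc that leaves a vertex of a component ends in the same component. *)
Lemma outdegree_component (S : {set T * T}) x y : y \in component S x ->
  outdegree (component_arcs S x) y = outdegree S y.
Proof.
rewrite inE => xy; apply: eq_card => z; rewrite !inE /= xy.
case yz: ((y, z) \in S) => //=.
by rewrite (connect_trans xy) // connect1 // underlyingE yz.
Qed.

Lemma outdegree_fun_arcs f x : outdegree (fun_arcs f) x = (f x != x).
Proof.
rewrite /outdegree; have [fx|fx] := eqVneq (f x) x.
  by apply: eq_card0 => y; rewrite inE in_fun_arcs fx eqxx andbF.
transitivity #|[set f x]%SET|; last by rewrite cards1.
by apply: eq_card => y; rewrite !inE /= fx andbT.
Qed.

Lemma converging_tree_rooted_fun_arcs f x : forest_fun f ->
  converging_tree_rooted (component (fun_arcs f) x) (component_arcs (fun_arcs f) x)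
    (sink f x).
Proof.
move=> Ff; set S := fun_arcs f; set V := component S x; set E := component_arcs S x.
have inV y : (y \in V) = (sink f x == sink f y) by rewrite inE connect_fun_arcs.
have ssink y : sink f (sink f y) = sink f y by rewrite sink_fixed ?forest_funP.
have subE : {subset E <= S} by move=> e; rewrite inE => /andP[].
apply/and4P; split.
- apply/andP; split; first (apply/andP; split).
  + by apply/set0Pn; exists x; rewrite inV.
  (* Each vertex of the component is joined to the root by its own iterates, all of which stay in
     the component. *)
  + have cs y : y \in V -> connect (underlying E) y (sink f x).
      move=> yV; move: (yV); rewrite inV => /eqP->; rewrite /sink.
      elim: #|T| => //= k IH; apply: connect_trans IH _.
      set w := iter k f y; have [->//|fw] := eqVneq (f w) w.
      have wV : w \in V.
        rewrite inV; move: yV; rewrite inV => /eqP->; rewrite /w.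
        by elim: k {w fw} => //= k /eqP->; rewrite sink_step.
      apply: connect1; rewrite underlyingE inE in_fun_arcs eqxx fw /= wV /=.
      by rewrite inV sink_step // -inV wV.
    apply/forall_inP=> y yV; apply/forall_inP=> z zV.
    apply: connect_trans (cs _ yV) _.
    by rewrite (sym_connect_sym (@underlying_sym _)) cs.
  + have [/forallP noloop /forallP nocyc] := andP (acyclic_fun_arcs Ff).
    have subU : subrel (underlying E) (underlying S).
      by move=> y z /orP[/subE yz|/subE zy]; apply/orP; [left|right].
    apply/andP; split; first by apply/forallP=> y; apply: contra (noloop y); apply: subU.
    apply/forallP=> k; apply/forallP=> c; apply/implyP=> k2.
    have /forallP/(_ c)/implyP/(_ k2) := nocyc k; apply: contra => /andP[cyc un].
    by rewrite /ucycleb un andbT (sub_cycle subU).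
- by rewrite inV ssink.
- by rewrite outdegree_component ?inV ?ssink // outdegree_fun_arcs forest_funP ?eqxx.
apply/forall_inP=> y yV; apply/implyP=> yx; rewrite outdegree_component //.
rewrite outdegree_fun_arcs -sink_fixedE //.
by move: yV yx; rewrite inV => /eqP->; rewrite eq_sym => ->.
Qed.

(** The default [x] turns a vertex without outgoing arc into a fixed point, that is, a root. *)
Definition fun_of_arcs (S : {set T * T}) : {ffun T -> T} :=
  [ffun x => odflt x [pick y | (x, y) \in S]].

Lemma fun_arcsK : cancel fun_arcs fun_of_arcs.
Proof.
move=> f; apply/ffunP=> x; rewrite ffunE; case: pickP => [y|/(_ (f x))] /=.
  by rewrite in_fun_arcs => /andP[/eqP].
by rewrite in_fun_arcs eqxx => /negbFE/eqP.
Qed.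

Lemma in_forest_outdegree (S : {set T * T}) x : in_forest S -> (outdegree S x <= 1)%N.
Proof.
move/forallP/(_ x)/existsP=> [r /and4P[_ rV r0 /forall_inP xs]].
have xV : x \in component S x by rewrite inE.
have [xr|xr] := eqVneq x r; last by have := xs _ xV; rewrite xr outdegree_component //= => /eqP->.
by move: r0; rewrite -xr outdegree_component // => /eqP->.
Qed.

Lemma in_forest_noloop (S : {set T * T}) x : in_forest S -> (x, x) \notin S.
Proof.
move/forallP/(_ x)/existsP=> [r /and4P[/andP[_ /andP[/forallP/(_ x) + _]] _ _ _]].
by apply: contra => xx; rewrite underlyingE !inE xx /= connect0.
Qed.

Lemma fun_of_arcsK (S : {set T * T}) : in_forest S -> fun_arcs (fun_of_arcs S) = S.
Proof.
move=> FS; apply/setP=> -[x y]; rewrite in_fun_arcs ffunE.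
case: pickP => [z xz|xS] /=; last by rewrite eqxx andbF xS.
have xx := in_forest_noloop x FS.
have zx : z != x by apply/eqP=> E; rewrite -{2}E xz in xx.
rewrite zx andbT; apply/eqP/idP => [->//|xy].
(* Two distinct heads [y] and [z] would give [x] outdegree at least 2. *)
have := in_forest_outdegree x FS; rewrite leqNgt; apply: contraNeq => yz.
apply: leq_trans (_ : #|[set y; z]%SET| <= _)%N; first by rewrite cards2 yz.
by apply: subset_leq_card; apply/subsetP=> t; rewrite !inE => /orP[]/eqP->.
Qed.

Lemma converging_tree_rooted_component_fun_arcs f x r :
  converging_tree_rooted (component (fun_arcs f) x) (component_arcs (fun_arcs f) x) r ->
  f r = r /\ connect (underlying (fun_arcs f)) x r.
Proof.
move=> /and4P[_ rV + _]; rewrite outdegree_component // outdegree_fun_arcs.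
by rewrite inE in rV; have [fr _|] := eqVneq (f r) r.
Qed.

Lemma forest_fun_in_forest f : in_forest (fun_arcs f) -> forest_fun f.
Proof.
move=> /forallP FS; apply/forallP=> x.
have [r /converging_tree_rooted_component_fun_arcs[fr]] := existsP (FS x).
move=> /connectP[p pp lp].
suff xr : fconnect f x r by rewrite (fconnect_sink xr fr) fr.
(* An undirected path to the root [r] yields a directed one. If the first edge is traversed
   backwards, so that [x = f y], then the directed path from [y] to [r] already passes through [x],
   or [y = r] and [x = r]. *)
elim: p x pp lp => [|y p IH] x /=; first by move=> _ ->.
move=> /andP[xy /IH{}IH] /IH yr; move: xy; rewrite underlyingE !in_fun_arcs.
case/orP=> /andP[/eqP E _]; first by apply: connect_trans yr; rewrite E fconnect1.
case/connectP: yr => -[|z q] /=.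
  by move=> _ rE; rewrite E -rE fr.
by move=> /andP[/eqP <- pq] ->; rewrite E; apply/connectP; exists q.
Qed.

Lemma in_forest_fun_arcs f : in_forest (fun_arcs f) = forest_fun f.
Proof.
apply/idP/idP => [|Ff]; first exact: forest_fun_in_forest.
by apply/forallP=> x; apply/existsP; exists (sink f x); apply: converging_tree_rooted_fun_arcs.
Qed.

Lemma in_tree_rooted_at_fun_arcs f x r : forest_fun f ->
  in_tree_rooted_at (fun_arcs f) x r = (sink f x == r).
Proof.
move=> Ff; apply/idP/eqP => [|<-]; last exact: converging_tree_rooted_fun_arcs.
case/converging_tree_rooted_component_fun_arcs=> fr.
by rewrite connect_fun_arcs // (sink_fixed fr) => /eqP.
Qed.

End ForestFunctions.

(** * Weighted sums over forests and their recursion *)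

Section ForestSums.
Variables (R : comNzRingType) (T : finType) (M : T -> T -> R).
Implicit Types (f : {ffun T -> T}) (i j m x : T) (k : nat).

Definition fun_weight f : R := \prod_(x | f x != x) M (f x) x.

(** The constant [phi = 1] gives sigma_k, and the indicator of [sink f j == i] gives the entry (i,
    j) of Q_k. *)
Definition forest_sum k (phi : {ffun T -> T} -> R) : R :=
  \sum_(f | forest_fun f && (arc_count f == k)) fun_weight f * phi f.

Lemma fun_weight_redirect f j m : f j = j -> m != j ->
  fun_weight (redirect f j m) = M m j * fun_weight f.
Proof.
move=> fj mj; rewrite /fun_weight (bigD1 j) /= redirect_at //; congr (_ * _).
apply: eq_big => [x|x /andP[_ xj]]; last by rewrite redirect_other.
have [->|xj] := eqVneq x j; first by rewrite fj eqxx andbF.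
by rewrite redirect_other // andbT.
Qed.

(** Deleting the arc from [j] to [m] is a bijection onto pairs of a forest with root [j] and one arc
    fewer, and a vertex [m] outside the tree of [j]. *)
Lemma sum_forest_redirect k j (G : {ffun T -> T} -> R) :
  \sum_(f | [&& forest_fun f, arc_count f == k & f j != j]) G f =
  \sum_(f | [&& forest_fun f, (arc_count f).+1 == k & f j == j])
    \sum_(m | sink f m != j) G (redirect f j m).
Proof.
rewrite pair_big_dep /=; symmetry.
rewrite [RHS](reindex_onto (fun p => redirect p.1 j p.2)
  (fun f => (redirect f j j, f j))) /=; last by move=> f _; apply: redirect_self.
apply: eq_bigl => -[f m] /=; rewrite redirect_at xpair_eqE eqxx andbT.
apply/idP/idP => [/andP[/and3P[Ff fk /eqP fj] mj]|/andP[/and3P[Fg gk mj] /eqP E]].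
  have mj' : m != j by apply: contraNneq mj => ->; rewrite (sink_fixed fj).
  by rewrite forest_fun_redirect // arc_count_redirect // fk mj' redirectK ?eqxx.
have fj : f j = j by rewrite -E redirect_at.
have Ff : forest_fun f by rewrite -E forest_fun_cut.
rewrite Ff fj eqxx -(arc_count_redirect fj mj) gk /=.
by have := @sink_cut _ (redirect f j m) j; rewrite redirect_at E; apply.
Qed.

(** Exchanging [x] and [y] changes the sign of the summand; splitting the difference avoids any
    division by 2. *)
Lemma antisym_sum (P : pred T) (c e : T -> R) :
  \sum_(x | P x) \sum_(y | P y) c x * (c y * (e x - e y)) = 0.
Proof.
transitivity (\sum_(x | P x) \sum_(y | P y) c x * (c y * e x) -
              \sum_(x | P x) \sum_(y | P y) c x * (c y * e y)).
  rewrite -sumrB; apply: eq_bigr => x _; rewrite -sumrB.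
  by apply: eq_bigr => y _; rewrite -!mulrBr.
rewrite [X in _ - X]exchange_big /= -[X in _ = X](subrr
  (\sum_(x | P x) \sum_(y | P y) c x * (c y * e x))); congr (_ - _).
by apply: eq_bigr => x _; apply: eq_bigr => y _; rewrite mulrCA.
Qed.

(* The forests in which [j] already has an outgoing arc contribute nothing:
   deleting that arc, they are pairs (smaller forest, arc out of [j]), and the
   sum over both arcs out of [j] is antisymmetric. *)
Lemma forest_sum_rec k i j :
  forest_sum k (fun f => \sum_m M m j * ((sink f j == i)%:R - (sink f m == i)%:R)) =
  forest_sum k.+1 (fun f => (i == j)%:R - (sink f j == i)%:R).
Proof.
have split_sum l phi : forest_sum l phi =
    \sum_(f | [&& forest_fun f, arc_count f == l & f j == j]) fun_weight f * phi f +
    \sum_(f | [&& forest_fun f, arc_count f == l & f j != j]) fun_weight f * phi f.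
  rewrite /forest_sum (bigID (fun f : {ffun T -> T} => f j == j)) /=.
  by congr (_ + _); apply: eq_bigl => f; rewrite andbA.
rewrite !split_sum [X in _ + X = _]sum_forest_redirect.
rewrite [X in _ + X = _]big1 ?addr0; last first.
  move=> f /and3P[Ff _ /eqP fj].
  have /(congr1 (GRing.mul (fun_weight f))) := antisym_sum
    (fun m => sink f m != j) (M^~ j) (fun m => (sink f m == i)%:R).
  rewrite mulr0; apply: etrans.
  rewrite mulr_sumr; apply: eq_bigr => m mj.
  have mj' : m != j by apply: contraNneq mj => ->; rewrite (sink_fixed fj).
  rewrite fun_weight_redirect // -mulrA mulrCA; congr (_ * _).
  rewrite -mulr_sumr; congr (_ * _).
  (* A head [m'] in the old tree of [j] now has the same root as [j], so only heads outside that
     tree contribute. *)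
  rewrite (bigID (fun m => sink f m == j)) /= big1 ?add0r => [|m' m'j].
    apply: eq_bigr => m' /negbTE m'j.
    by rewrite !sink_redirect // m'j (sink_fixed fj) eqxx.
  by rewrite !sink_redirect // m'j (sink_fixed fj) eqxx subrr mulr0.
(* On the right, the forests in which [j] is a root contribute zero. *)
rewrite [X in _ = X + _]big1 ?add0r; last first.
  move=> f /and3P[Ff _ /eqP fj].
  by rewrite (sink_fixed fj) eq_sym subrr mulr0.
(* The remaining forests on the right arise by adding an arc from [j] to [m], which makes the root
   of [m] the root of [j]; on the left, an [m] in the tree of [j] gives zero. *)
rewrite sum_forest_redirect; apply: eq_big => // f /and3P[Ff _ /eqP fj].
rewrite mulr_sumr (bigID (fun m => sink f m == j)) /= big1 ?add0r => [|m /eqP mj].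
  apply: eq_bigr => m mj.
  have mj' : m != j by apply: contraNneq mj => ->; rewrite (sink_fixed fj).
  rewrite fun_weight_redirect // sink_redirect // (sink_fixed fj) eqxx.
  by rewrite mulrA [_ * M m j]mulrC (eq_sym i).
by rewrite mj (sink_fixed fj) subrr !mulr0.
Qed.

Lemma forest_sum_sinks k x : \sum_i forest_sum k (fun f => (sink f x == i)%:R) =
  forest_sum k (fun=> 1).
Proof.
rewrite exchange_big /=; apply: eq_bigr => f _; rewrite -mulr_sumr.
congr (_ * _); rewrite (bigD1 (sink f x)) //= eqxx big1 ?addr0 // => i.
by rewrite eq_sym => /negbTE->.
Qed.

(** The trace counts the roots of each forest, and a forest with [k] arcs has [#|T| - k] of them. *)
Lemma forest_sum_trace k : \sum_i forest_sum k (fun f => (sink f i == i)%:R) =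
  (#|T| - k)%:R * forest_sum k (fun=> 1).
Proof.
rewrite exchange_big /= /forest_sum mulr_sumr; apply: eq_bigr => f /andP[Ff /eqP fk].
rewrite -mulr_sumr mulrCA mulr1; congr (_ * _); rewrite -natr_sum; congr _%:R.
rewrite -fk /arc_count -(cardsC [set x | f x != x]%SET) addKn -sum1_card.
rewrite [RHS]big_mkcond; apply: eq_bigr => x _.
by rewrite !inE negbK sink_fixedE //; case: eqP.
Qed.

Lemma arc_count0 f : (arc_count f == 0%N) = (f == [ffun x => x]).
Proof.
rewrite cards_eq0; apply/eqP/eqP=> [/setP E|->]; last first.
  by apply/setP=> x; rewrite !inE ffunE eqxx.
by apply/ffunP=> x; have := E x; rewrite !inE ffunE => /negbFE/eqP.
Qed.

Lemma forest_sum0 (phi : {ffun T -> T} -> R) :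
  forest_sum 0 phi = phi [ffun x => x].
Proof.
rewrite /forest_sum (big_pred1 [ffun x => x]).
  by rewrite /fun_weight big1 ?mul1r // => x; rewrite ffunE eqxx.
move=> f; rewrite arc_count0 /= andbC; case: eqP => //= ->.
by apply/forallP=> x; rewrite ffunE.
Qed.

End ForestSums.

(** * The forest matrices Q_k and the Laplacian *)

Section InForestMatrices.
Variables (R : realFieldType) (n : nat) (M : 'M[R]_n).
Hypothesis M_ge0 : forall i j, 0 <= M i j.

(* The condition [S \subset arcs M] can be dropped: arcs of weight 0 contribute 0. *)
Lemma set_weight_fun k (P : pred {set 'I_n * 'I_n}) :
  \sum_(S in forests M k | P S) weight M S =
  forest_sum M k (fun f => (P (fun_arcs f))%:R).
Proof.
transitivity (\sum_(S | [&& in_forest S, #|S| == k & P S]) weight M S).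
  rewrite [RHS](bigID (fun S : {set _} => S \subset arcs M)) /=.
  rewrite [X in _ = _ + X]big1 ?addr0 => [|S /andP[_ /subsetPn[e eS]]].
    by apply: eq_bigl => S; rewrite inE; rewrite -!andbA andbC -!andbA [P S && _]andbC.
  rewrite inE -leNgt => e0; rewrite /weight (bigD1 e) //=.
  by rewrite (le_anti (introT andP (conj e0 (M_ge0 _ _)))) mul0r.
rewrite (reindex_onto (@fun_arcs _) (@fun_of_arcs _)) => [|S /andP[SF _]]; last first.
  exact: fun_of_arcsK.
rewrite /forest_sum [RHS](bigID (fun f => P (fun_arcs f))) /= [X in _ = _ + X]big1 ?addr0.
  apply: eq_big => [f|f /andP[/and3P[_ _ ->] _]].
    by rewrite fun_arcsK eqxx andbT in_forest_fun_arcs card_fun_arcs andbA.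
  rewrite mulr1 /weight /fun_weight fun_arcsE big_imset /=.
    by apply: eq_bigl => x; rewrite inE.
  by move=> x y _ _ [].
by move=> f /andP[_ /negbTE->]; rewrite mulr0.
Qed.

Lemma sigma_fun k : sigma M k = forest_sum M k (fun=> 1).
Proof.
rewrite /sigma /set_weight -[RHS](set_weight_fun k predT).
by apply: eq_bigl => S; rewrite andbT.
Qed.

Lemma Qmx_fun k i j :
  Qmx M k i j = forest_sum M k (fun f => (sink f j == i)%:R).
Proof.
rewrite mxE /set_weight; under eq_bigl do rewrite inE.
rewrite (set_weight_fun k (fun S => in_tree_rooted_at S j i)).
by apply: eq_bigr => f /andP[Ff _]; rewrite in_tree_rooted_at_fun_arcs.
Qed.

Lemma forest_sum_ge0 k (phi : {ffun 'I_n -> 'I_n} -> R) :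
  (forall f, 0 <= phi f) -> 0 <= forest_sum M k phi.
Proof.
by move=> phi0; apply: sumr_ge0 => f _; rewrite mulr_ge0 // prodr_ge0.
Qed.

Lemma Qmx_ge0 k i j : 0 <= Qmx M k i j.
Proof. by rewrite Qmx_fun; apply: forest_sum_ge0 => f; rewrite ler0n. Qed.

Lemma sum_Qmx k j : \sum_i Qmx M k i j = sigma M k.
Proof. by under eq_bigr do rewrite Qmx_fun; rewrite forest_sum_sinks sigma_fun. Qed.

Lemma mxtrace_Qmx k : \tr (Qmx M k) = (n - k)%:R * sigma M k.
Proof.
rewrite sigma_fun; have := forest_sum_trace M k; rewrite card_ord => <-.
by apply: eq_bigr => i _; rewrite Qmx_fun.
Qed.

Lemma sigma0 : sigma M 0 = 1.
Proof. by rewrite sigma_fun forest_sum0. Qed.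

Lemma Qmx0 : Qmx M 0 = 1%:M.
Proof.
apply/matrixP=> i j; rewrite Qmx_fun forest_sum0 mxE sink_fixed ?ffunE //.
by rewrite eq_sym.
Qed.

Lemma mulmx_laplacian m (Y : 'M[R]_(m, n)) i j :
  (Y *m laplacian M) i j = \sum_x M x j * (Y i j - Y i x).
Proof.
rewrite mulmxBr mul_mx_diag !mxE mulr_sumr -sumrB.
by apply: eq_bigr => x _; rewrite mulrBr !(mulrC (M x j)).
Qed.

Lemma Qmx_rec k : Qmx M k *m laplacian M = (sigma M k.+1)%:M - Qmx M k.+1.
Proof.
apply/matrixP=> i j; rewrite mulmx_laplacian [RHS]mxE [X in _ = X + _]mxE [X in _ = _ + X]mxE.
under eq_bigr do rewrite !Qmx_fun -sumrB mulr_sumr.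
rewrite exchange_big /=.
transitivity (forest_sum M k
  (fun f => \sum_m M m j * ((sink f j == i)%:R - (sink f m == i)%:R))).
  apply: eq_bigr => f _; rewrite mulr_sumr; apply: eq_bigr => x _.
  by rewrite -mulrBr mulrCA.
rewrite forest_sum_rec sigma_fun Qmx_fun -[X in _ = X - _]mulr_natr mulr_suml -sumrB.
by apply: eq_bigr => f _; rewrite mulr1 mulrBr.
Qed.

(** By the recursion, Q_k is a polynomial in the Laplacian. *)
Lemma Qmx_comm k (Y : 'M[R]_n) : comm_mx Y (laplacian M) -> comm_mx Y (Qmx M k).
Proof.
move=> YL; elim: k => [|k IH]; first by rewrite Qmx0; apply: comm_mx1.
have -> : Qmx M k.+1 = (sigma M k.+1)%:M - Qmx M k *m laplacian M.
  by rewrite Qmx_rec opprB addrC subrK.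
apply: comm_mxB; first exact: comm_mx_scalar.
exact: comm_mxM.
Qed.

Lemma laplacian_Qmx k : laplacian M *m Qmx M k = (sigma M k.+1)%:M - Qmx M k.+1.
Proof. by rewrite -Qmx_rec; apply: (Qmx_comm k (comm_mx_refl _)). Qed.

(** The polynomial in the Laplacian that gives Q_k has constant term sigma_k. *)
Lemma Qmx_ker m k (Y : 'M[R]_(n, m)) : laplacian M *m Y = 0 ->
  Qmx M k *m Y = sigma M k *: Y.
Proof.
move=> LY; case: k => [|k]; first by rewrite Qmx0 sigma0 mul1mx scale1r.
have -> : Qmx M k.+1 = (sigma M k.+1)%:M - Qmx M k *m laplacian M.
  by rewrite Qmx_rec opprB addrC subrK.
by rewrite mulmxBl mul_scalar_mx -mulmxA LY mulmx0 subr0.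
Qed.

(** The entries are nonnegative and each column sums to sigma_k. *)
Lemma Qmx_eq0 k : sigma M k = 0 -> Qmx M k = 0.
Proof.
move=> s0; apply/matrixP=> i j; rewrite [RHS]mxE; apply/eqP.
have /eqP := sum_Qmx k j; rewrite s0 psumr_eq0 => [/allP/(_ i)|x _]; last exact: Qmx_ge0.
by rewrite mem_index_enum; apply.
Qed.

(** A forest on a nonempty vertex set has a root, hence fewer than [n] arcs. *)
Lemma sigma_size : (0 < n)%N -> sigma M n = 0.
Proof.
move=> n0; rewrite sigma_fun; apply: big1 => f /andP[Ff]; rewrite -[X in _ == X]card_ord.
rewrite -[#|'I_n|]cardsT /arc_count => /eqP fn.
have /setP/(_ (sink f (Ordinal n0))) : [set x | f x != x]%SET = [set: 'I_n]%SET.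
  by apply/eqP; rewrite eqEcard finset.subsetT fn leqnn.
by rewrite !inE forest_funP // eqxx.
Qed.

(* Maximum principle: a row vector killed by the Laplacian is harmonic at every
   vertex, so its maximum propagates along the arcs. *)
Lemma laplacian_left_kernel m (v : 'M[R]_(m, n)) : strongly_connected M ->
  v *m laplacian M = 0 -> forall r i j, v r i = v r j.
Proof.
move=> sc vL r; suff H (i : 'I_n) : exists i0, forall x, v r x = v r i0.
  by move=> i j; have [i0 E] := H i; rewrite !E.
case: (@arg_maxP _ _ _ i predT (v r) isT) => i0 _ vmax.
suff step p y : v r y = v r i0 -> path [rel x y | (x, y) \in arcs M] y p ->
    v r (last y p) = v r i0.
  by exists i0 => x; have /connectP[p pp ->] := sc i0 x; apply: step.
elim: p y => //= z p IH y vy /andP[yz]; apply: IH.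
(* As [v r y] is maximal, this vanishing sum has nonnegative terms, so each term is zero. *)
have /eqP := mulmx_laplacian v r y; rewrite vL mxE eq_sym psumr_eq0 => [|k _]; last first.
  by rewrite mulr_ge0 ?subr_ge0 // vy; apply: vmax.
move=> /allP/(_ z); rewrite mem_index_enum mulf_eq0 => /(_ isT) /orP[/eqP M0|].
  by move: yz; rewrite inE /= M0 ltxx.
by rewrite subr_eq0 vy eq_sym => /eqP.
Qed.

(* If [sigma k] is the last nonzero coefficient, [Qmx k] has constant rows, so
   its trace is its column sum [sigma k]; but that trace is [(n - k) * sigma k]. *)
Lemma sigma_neq0 k : strongly_connected M -> (k < n)%N -> sigma M k != 0.
Proof.
move=> sc; elim: k => [|k IH] kn; first by rewrite sigma0 oner_eq0.
have sk := IH (ltnW kn); apply/eqP=> s0.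
have /(laplacian_left_kernel sc) Qc : Qmx M k *m laplacian M = 0.
  by rewrite Qmx_rec Qmx_eq0 // s0 raddf0 subr0.
have n0 : (0 < n)%N by apply: leq_trans kn.
have /eqP : \tr (Qmx M k) = sigma M k.
  by rewrite -(sum_Qmx k (Ordinal n0)); apply: eq_bigr => i _; apply: Qc.
rewrite mxtrace_Qmx -subr_eq0 -{2}[sigma M k]mul1r -mulrBl mulf_eq0 (negbTE sk) orbF.
(* Cancelling sigma_k leaves [n - k = 1], against [k.+1 < n]. *)
rewrite subr_eq0 (eqr_nat R _ 1) => /eqP nk.
by rewrite -addn1 -ltn_subRL nk in kn.
Qed.

Lemma Qmx_last k : k.+1 = n -> Qmx M k *m laplacian M = 0.
Proof.
move=> kn; have sn : sigma M k.+1 = 0 by rewrite kn sigma_size // -kn.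
by rewrite Qmx_rec Qmx_eq0 // sn raddf0 subr0.
Qed.

Lemma laplacian_Qmx_last k : k.+1 = n -> laplacian M *m Qmx M k = 0.
Proof.
by move=> kn; rewrite -(Qmx_last kn); apply: (Qmx_comm k (comm_mx_refl _)).
Qed.

(** Constant rows let the entry of Q_{n-1} be pulled out of the product in Q_{n-1} y = sigma_{n-1}
    y. *)
Lemma Qmx_last_ker k (y : 'cV[R]_n) : k.+1 = n -> strongly_connected M ->
  laplacian M *m y = 0 ->
  forall i j, Qmx M k i j * (\sum_l y l 0) = sigma M k * y i 0.
Proof.
move=> kn sc Ly i j; have /matrixP/(_ i 0) E := Qmx_ker k Ly; rewrite [LHS]mxE [RHS]mxE in E.
rewrite -E mulr_sumr; apply: eq_bigr => l _; congr (_ * _).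
exact: laplacian_left_kernel sc (Qmx_last kn) _ _ _.
Qed.

End InForestMatrices.

(** * The absorption inverse of the scaled graph's unscaled Laplacian *)

Section AbsorptionInverse.
Variables (R : realFieldType) (n : nat) (A : 'M[R]_n) (d : 'cV[R]_n).
Hypothesis A_ge0 : forall i j, 0 <= A i j.
Hypothesis d_gt0 : forall i, 0 < d i 0.
Local Notation At := (absorption_scaled A d).

Lemma invmx_Dmx : invmx (Dmx d) = diag_mx (\row_i (d i 0)^-1).
Proof.
have DI : Dmx d *m diag_mx (\row_i (d i 0)^-1) = 1%:M.
  rewrite mul_diag_mx; apply/matrixP=> i j; rewrite !mxE.
  have [->|_] := eqVneq i j; last by rewrite mulr0.
  by rewrite mulr1n divff // gt_eqF.
have [uD _] := mulmx1_unit DI.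
by rewrite -[LHS]mulmx1 -DI mulmxA mulVmx // mul1mx.
Qed.

Lemma Dmx_unit : Dmx d \in unitmx.
Proof.
rewrite unitmxE det_diag unitfE; apply/prodf_neq0 => i _.
by rewrite mxE gt_eqF.
Qed.

Lemma absorption_scaledE i j : At i j = A i j / d j 0.
Proof. by rewrite /absorption_scaled invmx_Dmx mul_mx_diag !mxE. Qed.

Lemma absorption_scaled_ge0 i j : 0 <= At i j.
Proof. by rewrite absorption_scaledE divr_ge0 // ltW. Qed.

Lemma absorption_scaled_arcs : arcs At = arcs A.
Proof. by apply/setP=> e; rewrite !inE absorption_scaledE pmulr_lgt0 // invr_gt0. Qed.

Lemma absorption_scaled_connected : strongly_connected A -> strongly_connected At.
Proof. by rewrite /strongly_connected absorption_scaled_arcs. Qed.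

(** Column [j] of [A] is divided by d_j, hence so is its sum, the outdegree of [j]. *)
Lemma laplacian_absorption_scaled : laplacian At = laplacian A *m invmx (Dmx d).
Proof.
rewrite mulmxBl; congr (_ - _); rewrite invmx_Dmx mul_mx_diag.
apply/matrixP=> i j; rewrite !mxE mulrnAl; have [->|//] := eqVneq i j.
by rewrite mulr1n mulr_suml; apply: eq_bigr => x _; rewrite absorption_scaledE.
Qed.

Lemma laplacian_unscale : laplacian A = laplacian At *m Dmx d.
Proof. by rewrite laplacian_absorption_scaled mulmxKV // Dmx_unit. Qed.

Variable k : nat.
Hypothesis kn : k.+2 = n.
Hypothesis A_conn : strongly_connected A.

Let sc := absorption_scaled_connected A_conn.
Let At_ge0 := absorption_scaled_ge0.

Let Z : 'M[R]_n := Qmx At k - (sigma At k / sigma At k.+1) *: Qmx At k.+1.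

Let s1_neq0 : sigma At k.+1 != 0.
Proof. by rewrite sigma_neq0 // -kn. Qed.

Let LZ : laplacian At *m Z + Qmx At k.+1 = (sigma At k.+1)%:M.
Proof.
by rewrite mulmxBr -scalemxAr (laplacian_Qmx_last At_ge0 kn) scaler0 subr0 laplacian_Qmx // subrK.
Qed.

Let ZL : Z *m laplacian At + Qmx At k.+1 = (sigma At k.+1)%:M.
Proof.
by rewrite mulmxBl -scalemxAl (Qmx_last At_ge0 kn) scaler0 subr0 Qmx_rec // subrK.
Qed.

(** The columns of Q_{n-1} lie in the kernel of L~, where Q_{n-2} and Q_{n-1} act as the scalars
    sigma_{n-2} and sigma_{n-1}; commuting the factors gives the claim. *)
Let QZ : Qmx At k.+1 *m Z = 0.
Proof.
have Lq := laplacian_Qmx_last At_ge0 kn.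
have qQ : Qmx At k.+1 *m Qmx At k = Qmx At k *m Qmx At k.+1.
  by apply: Qmx_comm => //; rewrite /comm_mx Lq (Qmx_last At_ge0 kn).
rewrite mulmxBr -scalemxAr qQ !Qmx_ker // scalerA divfK // subrr //.
Qed.

Let Zker m (y : 'M[R]_(n, m)) : laplacian At *m y = 0 -> Z *m y = 0.
Proof.
by move=> Ly; rewrite mulmxBl -scalemxAl !Qmx_ker // scalerA divfK // subrr.
Qed.

Lemma absorption_inverse_forests :
  is_absorption_inverse (laplacian A) d ((sigma At k.+1)^-1 *: (invmx (Dmx d) *m Z)).
Proof.
split=> y.
  (* D y lies in the range of L~, which Q_{n-1} kills, so Z L~ acts on it as the scalar
     sigma_{n-1}. *)
  case=> z _ Lz; have Dy0 : Qmx At k.+1 *m (Dmx d *m y) = 0.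
    by rewrite -Lz laplacian_unscale -!mulmxA mulmxA (Qmx_last At_ge0 kn) mul0mx.
  rewrite -!scalemxAl {1}laplacian_unscale -!mulmxA (mulmxA Z).
  have -> : Z *m laplacian At *m (Dmx d *m y) = sigma At k.+1 *: (Dmx d *m y).
    by rewrite -[RHS]mul_scalar_mx -ZL mulmxDl Dy0 addr0.
  by rewrite -scalemxAr scalerA mulVf // scale1r mulmxA mulVmx ?Dmx_unit // mul1mx.
case=> x /= Lx <-; rewrite -scalemxAl -mulmxA Zker ?mulmx0 ?scaler0 //.
by rewrite mulmxA -laplacian_unscale.
Qed.

(** Decompose sigma_{n-1} y = L~ Z y + Q_{n-1} y. The last term lies in R_{1,0}, where [X] vanishes,
    and L~ Z y is L applied to D^-1 Z y in N_{1,0}, where X L is the identity. *)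
Lemma absorption_inverse_unique X : is_absorption_inverse (laplacian A) d X ->
  X = (sigma At k.+1)^-1 *: (invmx (Dmx d) *m Z).
Proof.
move=> [XL X0]; apply: (scalerI s1_neq0); rewrite scalerA divff // scale1r.
rewrite -mul_mx_scalar -LZ mulmxDr.
have eq_mulmx (Y Y' : 'M[R]_n) : (forall y : 'cV_n, Y *m y = Y' *m y) -> Y = Y'.
  move=> YY'; apply/matrixP=> i j; have := YY' (delta_mx j 0).
  by rewrite -!colE => /matrixP/(_ i 0); rewrite !mxE.
apply: eq_mulmx => y; rewrite mulmxDl -[X *m Qmx _ _ *m y]mulmxA.
rewrite [X *m (Qmx _ _ *m y)]X0 ?addr0; last first.
  exists (invmx (Dmx d) *m (Qmx At k.+1 *m y)); last by rewrite mulmxA mulmxV ?Dmx_unit ?mul1mx.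
  by rewrite /= mulmxA -laplacian_absorption_scaled mulmxA (laplacian_Qmx_last At_ge0 kn) mul0mx.
rewrite laplacian_absorption_scaled -!mulmxA [X *m _]mulmxA XL //.
(* The witness comes from L~ Q_{n-2} = sigma_{n-1} I - Q_{n-1} applied to Z y, together with Q_{n-1}
   Z = 0. *)
exists ((sigma At k.+1)^-1 *: (invmx (Dmx d) *m (Qmx At k *m (Z *m y)))) => //.
rewrite [Dmx d *m _]mulmxA mulmxV ?Dmx_unit // mul1mx -scalemxAr.
rewrite [laplacian A *m _]mulmxA -laplacian_absorption_scaled mulmxA laplacian_Qmx // mulmxBl mul_scalar_mx.
by rewrite mulmxA QZ mul0mx subr0 scalerA mulVf // scale1r.
Qed.

Lemma absorption_inverseE : absorption_inverse (laplacian A) d =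
  (sigma At k.+1)^-1 *: (invmx (Dmx d) *m Z).
Proof.
rewrite /absorption_inverse; apply: classical_sets.xget_subset1.
  exact: absorption_inverse_forests.
by move=> X Y /absorption_inverse_unique-> /absorption_inverse_unique->.
Qed.

End AbsorptionInverse.

(** * The forest formula, in matrix form and entrywise *)

Theorem theorem6 (R : realFieldType) (n : nat) (A : 'M[R]_n)
    (d u : 'cV[R]_n)
    (hn : (2 <= n)%N)
    (hA : forall i j, 0 <= A i j)
    (hG : strongly_connected A)
    (hd : forall i, 0 < d i 0)
    (hLu : laplacian A *m u = 0)
    (hu : forall i, 0 < u i 0)
    (hu1 : \sum_i u i 0 = 1) :
  let At := absorption_scaled A d in
  let Ld := absorption_inverse (laplacian A) d in
  let dbar := (d^T *m u) 0 0 in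
  Ld = (sigma At (n - 2) / sigma At (n - 1)) *:
         (invmx (Dmx d) *m (Jmx At (n - 2) - Jmx At (n - 1))) /\
  (forall i j : 'I_n,
     Ld i j = set_weight At (forests_to At (n - 2) j i)
                / (d i 0 * sigma At (n - 1))
              - (sigma At (n - 2) * u i 0) / (sigma At (n - 1) * dbar)).
Proof.
move=> At Ld dbar.
(* Since [2 <= n], the truncated subtractions can be replaced by [k] and [k.+1]. *)
have kn : (n - 2).+2 = n by rewrite -addn2 subnK.
have -> : (n - 1 = (n - 2).+1)%N by rewrite -[X in (X - 1)%N]kn subn1.
move: (n - 2)%N kn => k kn.
have LdE : Ld = _ := absorption_inverseE hA hd kn hG.
have At_ge0 := absorption_scaled_ge0 hA hd.
have sc : strongly_connected At := absorption_scaled_connected hd hG.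
have s0 : sigma At k != 0 by rewrite sigma_neq0 // -kn ltnS leqnSn.
have s1 : sigma At k.+1 != 0 by rewrite sigma_neq0 // -kn.
split.
  rewrite LdE -/At /Jmx !mulmxBr -!scalemxAr !scalerBr !scalerA.
  congr (_ *: _ - _ *: _); first by rewrite mulrAC divff // mul1r.
  by rewrite mulrC.
move=> i j.
have dbarE : dbar = \sum_l (Dmx d *m u) l 0.
  by rewrite /dbar mxE; apply: eq_bigr => l _; rewrite mul_diag_mx !mxE.
have n0 : (0 < n)%N by rewrite -kn.
have dbar_neq0 : dbar != 0.
  rewrite /dbar mxE psumr_neq0 => [|l _]; last by rewrite mxE mulr_ge0 // ltW.
  by apply/hasP; exists (Ordinal n0); rewrite ?mem_index_enum //= mxE mulr_gt0.
have LDu : laplacian At *m (Dmx d *m u) = 0.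
  by rewrite mulmxA -laplacian_unscale.
(* D u spans the kernel of L~ and its entries sum to [dbar], which fixes the constant rows of
   Q_{n-1}. *)
have Q1 : Qmx At k.+1 i j = sigma At k.+1 * (d i 0 * u i 0) / dbar.
  apply: (mulIf dbar_neq0); rewrite divfK // dbarE (Qmx_last_ker At_ge0 kn sc LDu).
  by rewrite mul_diag_mx !mxE.
have di : d i 0 != 0 by rewrite gt_eqF.
have Q0 : set_weight At (forests_to At k j i) = Qmx At k i j by rewrite [RHS]mxE.
have mxE_sub (B C : 'M[R]_n) c : (B - c *: C) i j = B i j - c * C i j.
  by rewrite !mxE.
rewrite Q0 LdE -/At (invmx_Dmx hd) mul_diag_mx [LHS]mxE [X in _ * X = _]mxE.
rewrite [X in _ * (X * _)]mxE mxE_sub Q1; clear mxE_sub Q0 Q1 dbarE.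
move: (sigma _ _) (sigma _ _) (Qmx _ _ _ _) s0 s1 => s t q s0 s1.
by field; rewrite s1 dbar_neq0 di.
Qed.
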